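(* Let $\mathcal{X},\mathcal{Y},\mathcal{Z},\tilde{\mathcal{Z}},\mathfrak{Z}$ be finite dimensional real Hilbert spaces, $\mathbf{C}\subset\mathfrak{Z}$ nonempty closed convex, $\Psi\in\Gamma_0(\mathcal{Z})$ coercive with $\operatorname{dom}\Psi=\mathcal{Z}$, $y\in\mathcal{Y}$, and let $(A,B,\mathfrak{L},\mathfrak{C},\mu)\in\mathcal{B}(\mathcal{X},\mathcal{Y})\times\mathcal{B}(\mathcal{Z},\tilde{\mathcal{Z}})\times\mathcal{B}(\mathcal{X},\mathcal{Z})\times\mathcal{B}(\mathcal{X},\mathfrak{Z})\times\mathbb{R}_{++}$ satisfy $\mathbf{C}\cap\operatorname{ran}\mathfrak{C}\neq\emptyset$. Define $\mathcal{Z}_c:=\mathcal{Z}\times\mathfrak{Z}$, $\tilde{\mathcal{Z}}_c:=\tilde{\mathcal{Z}}\times\mathfrak{Z}$, $\mathfrak{L}_c:\mathcal{X}\to\mathcal{Z}_c:x\mapsto(\mathfrak{L}x,\mathfrak{C}x)$, $B_c:=B\oplus\mathrm{O}_{\mathfrak{Z}}:\mathcal{Z}_c\to\tilde{\mathcal{Z}}_c:(z_1,z_2)\mapsto(Bz_1,0_{\mathfrak{Z}})$, and the convex function $\mathbf{\Psi}:=\Psi\oplus\iota_{\mathbf{C}}\in\Gamma_0(\mathcal{Z}_c)$, $\mathbf{\Psi}(z_1,z_2):=\Psi(z_1)+\iota_{\mathbf{C}}(z_2)$. Put $$\mathbf{\Psi}_{B_c}(\cdot):=\mathbf{\Psi}(\cdot)-\min_{v\in\mathcal{Z}_c}\Big[\mathbf{\Psi}(v)+\tfrac12\|B_c(\cdot-v)\|_{\tilde{\mathcal{Z}}_c}^2\Big].$$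 Then $\mathbf{\Psi}_{B_c}(z_1,z_2)=\Psi_B(z_1)+\iota_{\mathbf{C}}(z_2)$ for all $(z_1,z_2)\in\mathcal{Z}_c$, and the constrained problem $$\operatorname*{minimize}_{\mathfrak{C}x\in\mathbf{C}}\ \tfrac12\|y-Ax\|_{\mathcal{Y}}^2+\mu\,\Psi_B\circ\mathfrak{L}(x)$$ can be formulated equivalently as the constraint-free problem $$\operatorname*{minimize}_{x\in\mathcal{X}}\ J_{\mathbf{\Psi}_{B_c}\circ\mathfrak{L}_c}(x):=\tfrac12\|y-Ax\|_{\mathcal{Y}}^2+\mu\,\mathbf{\Psi}_{B_c}\circ\mathfrak{L}_c(x),$$ in the sense that $J_{\mathbf{\Psi}_{B_c}\circ\mathfrak{L}_c}(x)$ equals $\tfrac12\|y-Ax\|_{\mathcal{Y}}^2+\mu\Psi_B(\mathfrak{L}x)$ if $\mathfrak{C}x\in\mathbf{C}$ and equals $\infty$ otherwise.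
   Context: $\mathbb{R}_{++}$ is the set of positive reals; $\mathcal{B}(\mathcal{H},\mathcal{K})$ is the set of linear operators $\mathcal{H}\to\mathcal{K}$; $\operatorname{ran}$ the range. $\Gamma_0(\mathcal{H})$ is the set of proper lower semicontinuous convex functions $\mathcal{H}\to(-\infty,\infty]$; $\operatorname{dom}\Psi:=\{z\mid\Psi(z)<\infty\}$; coercive means $\Psi(z)\to\infty$ as $\|z\|\to\infty$. $\iota_{\mathbf{C}}$ is the indicator function of $\mathbf{C}$ ($0$ on $\mathbf{C}$, $\infty$ elsewhere). Product spaces carry the sum inner product. The generalized Moreau enhanced (GME) penalty is $$\Psi_B(\cdot):=\Psi(\cdot)-\min_{v\in\mathcal{Z}}\Big[\Psi(v)+\tfrac12\|B(\cdot-v)\|_{\tilde{\mathcal{Z}}}^2\Big].$$ *)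

(* Defs.v *)
From HB Require Import structures.
From mathcomp Require Import all_boot all_order all_algebra.
From mathcomp Require Import sesquilinear ring lra.
From mathcomp Require Import boolp classical_sets reals ereal topology.
From mathcomp Require Import normedtype convex.

Set Implicit Arguments.
Unset Strict Implicit.
Unset Printing Implicit Defensive.

Import Order.TTheory GRing.Theory Num.Theory.
Import numFieldNormedType.Exports.

Local Open Scope classical_set_scope.
Local Open Scope ring_scope.

(* The norm, hence the topology, is the one induced by the inner product.
   Completeness is not required separately: it is automatic in finite
   dimension. *)
HB.mixin Record NormedModule_isFinHilbert (R : realType) H
    & NormedModule R H & Vector R H := {
  inner : {dot H for @idfun R} ;
  normr_inner : forall x : H, `|x| = Num.sqrt (inner x x)
}.

#[short(type="finHilbertType")]
HB.structure Definition FinHilbert (R : realType) :=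
  {H of NormedModule R H & Vector R H & NormedModule_isFinHilbert R H}.

Section HilbertProduct.
Context {R : realType} (H K : finHilbertType R).

(* The alias is needed because the library norm on [H * K] is the max norm. *)
Definition hprod : Type := (H * K)%type.

Set Warnings "-redundant-canonical-projection".
HB.instance Definition _ := Vector.copy hprod (H * K)%type.

Definition hprod_inner (x y : hprod) : R :=
  inner x.1 y.1 + inner x.2 y.2.

Lemma hprod_inner_bilinear : bilinear_for *%R (@idfun R \; *%R) hprod_inner.
Proof.
split=> u a x y; rewrite /hprod_inner/=.
  by rewrite !linearPl mulrDr addrACA.
by rewrite !linearPr mulrDr addrACA.
Qed.

HB.instance Definition _ :=
  bilinear_isBilinear.Build R hprod hprod R *%R (@idfun R \; *%R)
    hprod_inner hprod_inner_bilinear.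

Lemma hprod_innerC (x y : hprod) :
  hprod_inner x y = (-1) ^+ false * @idfun R (hprod_inner y x).
Proof.
by rewrite /hprod_inner/= (hermC inner x.1) (hermC inner x.2)/= !mul1r.
Qed.

HB.instance Definition _ :=
  isHermitianSesquilinear.Build R hprod false (@idfun R) hprod_inner
    hprod_innerC.

Lemma hprod_innerE (x : hprod) :
  hprod_inner x x = `|x.1| ^+ 2 + `|x.2| ^+ 2.
Proof.
have ge0 (V : finHilbertType R) (v : V) : 0 <= inner v v.
  have [->|v0] := eqVneq v 0; first by rewrite linear0r.
  exact/ltW/neq0_dnorm_gt0.
by rewrite /hprod_inner !normr_inner !sqr_sqrtr.
Qed.

Lemma hprod_inner_gt0 (x : hprod) : x != 0 -> 0 < hprod_inner x x.
Proof.
case: x => a b ab0; rewrite hprod_innerE/= lt_neqAle addr_ge0// andbT eq_sym.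
rewrite paddr_eq0// !sqrf_eq0 !normr_eq0.
by apply: contra ab0 => /andP[/eqP-> /eqP->].
Qed.

HB.instance Definition _ :=
  isDotProduct.Build R hprod hprod_inner hprod_inner_gt0.

Definition hprod_norm (x : hprod) : R := Num.sqrt (hprod_inner x x).

Lemma hprod_normD (x y : hprod) :
  hprod_norm (x + y) <= hprod_norm x + hprod_norm y.
Proof.
rewrite -ler_sqr ?nnegrE ?addr_ge0 ?sqrtr_ge0//.
rewrite /hprod_norm !hprod_innerE sqrrD !sqr_sqrtr ?addr_ge0//=.
have /= := ler_normD x.1 y.1; have /= := ler_normD x.2 y.2.
set a := `|x.1|; set b := `|x.2|; set c := `|y.1|; set d := `|y.2|.
move=> nD2 nD1.
have [a0 b0] : 0 <= a /\ 0 <= b by split; exact: normr_ge0.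
have [c0 d0] : 0 <= c /\ 0 <= d by split; exact: normr_ge0.
have acbd : a * c + b * d
    <= Num.sqrt (a ^+ 2 + b ^+ 2) * Num.sqrt (c ^+ 2 + d ^+ 2).
  rewrite -sqrtrM ?addr_ge0 ?sqr_ge0//.
  rewrite -[leLHS]ger0_norm ?addr_ge0 ?mulr_ge0// -sqrtr_sqr.
  apply: ler_wsqrtr; rewrite -subr_ge0.
  by rewrite (_ : _ - _ = (a * d - b * c) ^+ 2) ?sqr_ge0//; ring.
have sq1 : `|x.1 + y.1| ^+ 2 <= (a + c) ^+ 2 by rewrite ler_sqr ?nnegrE ?addr_ge0.
have sq2 : `|x.2 + y.2| ^+ 2 <= (b + d) ^+ 2 by rewrite ler_sqr ?nnegrE ?addr_ge0.
apply: le_trans (lerD sq1 sq2) _.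
by rewrite !sqrrD; lra.
Qed.

Lemma hprod_normZ (l : R) (x : hprod) :
  hprod_norm (l *: x) = `|l| * hprod_norm x.
Proof.
rewrite /hprod_norm !hprod_innerE/= !normrZ !exprMn -mulrDr sqrtrM ?sqr_ge0//.
by rewrite sqrtr_sqr normr_id.
Qed.

Lemma hprod_norm_eq0 (x : hprod) : hprod_norm x = 0 -> x = 0.
Proof.
move=> /eqP; rewrite sqrtr_eq0; apply: contraTeq => x0.
by rewrite -ltNge hprod_inner_gt0.
Qed.

HB.instance Definition _ :=
  Lmodule_isNormed.Build R hprod hprod_normD hprod_normZ hprod_norm_eq0.

Lemma hprod_normr_inner (x : hprod) : `|x| = Num.sqrt (hprod_inner x x).
Proof. by []. Qed.

HB.instance Definition _ :=
  NormedModule_isFinHilbert.Build R hprod hprod_normr_inner.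

End HilbertProduct.

Section ExtendedRealFunctions.
Context {R : realType} {H : finHilbertType R}.
Implicit Type f : H -> \bar R.
Local Open Scope ereal_scope.

Definition proper f := (forall x, -oo < f x) /\ exists x, f x < +oo.

Definition econvex f := forall (x y : H) (t : R), (0 <= t <= 1)%R ->
  f (t *: x + (1 - t) *: y)%R <= t%:E * f x + (1 - t)%:E * f y.

Definition Gamma0 f := [/\ proper f, lower_semicontinuous f & econvex f].

Definition edom f : set H := [set x | f x < +oo].

Definition coercive f :=
  forall M : R, exists r : R, forall x, (r < `|x|)%R -> M%:E < f x.

Definition eindic (C : set H) (x : H) : \bar R :=
  if x \in C then 0 else +oo.

End ExtendedRealFunctions.

Definition emin {R : realType} {T : Type} (f : T -> \bar R) : \bar R :=
  ereal_inf (range f).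

(* The infimum [emin f] is a genuine minimum exactly when [min_attained f] holds. *)
Definition min_attained {R : realType} {T : Type} (f : T -> \bar R) :=
  exists v, f v = emin f.

Section GME.
Context {R : realType} {Z Zt : finHilbertType R}.
Variables (Psi : Z -> \bar R) (B : {linear Z -> Zt}).
Local Open Scope ereal_scope.

Definition GME_objective (z v : Z) : \bar R :=
  Psi v + (2^-1 * `|B (z - v)| ^+ 2)%:E.

Definition GME (z : Z) : \bar R := Psi z - emin (GME_objective z).

End GME.

Definition penalized_ls {R : realType} {X Y : finHilbertType R}
    (A : {linear X -> Y}) (y : Y) (mu : R) (pen : X -> \bar R) (x : X) :
    \bar R :=
  ((2^-1 * `|y - A x| ^+ 2)%:E + mu%:E * pen x)%E.

Section ProductConstructions.
Context {R : realType} {X Z Zt K : finHilbertType R}.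

Definition pair_op (L : {linear X -> Z}) (D : {linear X -> K}) (x : X) :
  hprod Z K := (L x, D x).

Lemma pair_op_is_linear L D : linear (pair_op L D).
Proof. by move=> a x y; rewrite /pair_op !linearP. Qed.

HB.instance Definition _ L D :=
  GRing.isLinear.Build R X (hprod Z K) _ (pair_op L D)
    (pair_op_is_linear L D).

Definition oplus_zero (B : {linear Z -> Zt}) (z : hprod Z K) : hprod Zt K :=
  (B z.1, 0).

Lemma oplus_zero_is_linear B : linear (oplus_zero B).
Proof.
move=> a x y; rewrite /oplus_zero/= linearP.
by congr pair; symmetry; rewrite [LHS]addr0; exact: scaler0.
Qed.

HB.instance Definition _ B :=
  GRing.isLinear.Build R (hprod Z K) (hprod Zt K) _ (oplus_zero B)
    (oplus_zero_is_linear B).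

Definition oplus_indic (Psi : Z -> \bar R) (C : set K) (z : hprod Z K) :
  \bar R := (Psi z.1 + eindic C z.2)%E.

End ProductConstructions.

(* Main.v *)
Require Import Defs.
From HB Require Import structures.
From mathcomp Require Import all_boot all_order all_algebra.
From mathcomp Require Import interval_inference.
From mathcomp Require Import boolp classical_sets reals ereal topology.
From mathcomp Require Import normedtype convex derive.

Set Implicit Arguments.
Unset Strict Implicit.
Unset Printing Implicit Defensive.

Import Order.TTheory GRing.Theory Num.Theory.
Import numFieldNormedType.Exports.
Import VectorInternalTheory.

Local Open Scope classical_set_scope.
Local Open Scope ring_scope.

(** The sum objective splits: since the second component of [oplus_zero B] is
    zero,
      [GME_objective Psic Bc (z1, z2) (v1, v2)
         = GME_objective Psi B z1 v1 + eindic C v2],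
    and minimizing over [v2] just picks a point of the nonempty set [C], where
    the indicator vanishes. Hence both minima agree
    ([emin_GME_objective_oplus]), and subtracting this common value from
    [Psi z1 + eindic C z2] gives the penalty formula. When [D x] is not in [C]
    the penalty is thus [GME Psi B (L x) + +oo], which is [+oo] rather than an
    indeterminate sum as soon as the common minimum is finite, and the positive
    weight [mu] preserves it.

    The analytic content is therefore that the minimum exists, which also makes
    it finite, [Psi] being finite everywhere. Its existence is the direct method
    ([lsc_coercive_min_attained]): coercivity confines the problem to a closed
    ball, closed balls are compact in finite dimension, and a lower
    semicontinuous function attains its minimum on a compact set. The norm of a
    [finHilbertType] is abstract, so compactness of balls and continuity of
    linear maps are transported from row vectors along the coordinate
    isomorphism [r2v]; this is the equivalence of norms, whose nontrivial half
    is [rV_linear_lower_bound]. *)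

(** * Lower semicontinuous functions *)

Lemma ereal_lt_dense (R : realFieldType) (a b : \bar R) :
  (a < b)%E -> exists r : R, (a < r%:E < b)%E.
Proof.
case: a b => [a| |] [b| |] //=; rewrite ?lte_fin => ab.
- by exists ((a + b) / 2); rewrite !lte_fin !midf_lt.
- by exists (a + 1); rewrite lte_fin ltrDl ltr01 ltry.
- by exists (b - 1); rewrite lte_fin gtrDl ltrN10 ltNyr.
- by exists 0; rewrite ltNyr ltry.
Qed.

Section Lsc.
Context {R : realType}.

(** Where one summand is [-oo] the sum is [-oo], which lies above no real.
    Elsewhere a real bound [a] on the sum splits as
    [b + (a - b)] with [b] below [f x] and [a - b] below [g x]. *)
Lemma lscD (T : topologicalType) (f g : T -> \bar R) :
  lower_semicontinuous f -> lower_semicontinuous g ->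
  lower_semicontinuous (fun x => f x + g x)%E.
Proof.
move=> lf lg x a afg.
have [gNy fNy] : (-oo < g x /\ -oo < f x)%E.
  by move: afg; case: (f x) (g x) => [?| |] [?| |]; rewrite //= ?ltNyr.
have /ereal_lt_dense[b /andP[agb bf]] : (a%:E - g x < f x)%E.
  by move: afg gNy fNy; case: (f x) (g x) => [?| |] [?| |];
    rewrite //= ?ltNyr ?ltry// -!EFinD !lte_fin ltrBlDr.
have abg : ((a - b)%:E < g x)%E.
  by move: agb gNy; case: (g x) => [?| |];
    rewrite ?ltry//= !lte_fin ltrBlDl ltrBlDr.
have [V Vx fV] := lf x b bf.
have [W Wx gW] := lg x (a - b) abg.
exists (V `&` W) => [|y [Vy Wy]]; first exact: filterI.
by rewrite -(subrKC b a) EFinD lteD ?fV ?gW.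
Qed.

Lemma lsc_comp (S T : topologicalType) (h : S -> T) (f : T -> \bar R) :
  continuous h -> lower_semicontinuous f -> lower_semicontinuous (f \o h).
Proof.
move=> ch lf x a afx; have [V Vx fV] := lf _ _ afx.
by exists (h @^-1` V) => [|y]; [exact: ch|exact: fV].
Qed.

Lemma continuous_lsc (T : topologicalType) (g : T -> R) :
  continuous g -> lower_semicontinuous (fun x => (g x)%:E).
Proof.
move=> cg; apply: (lsc_comp cg) => r a /=; rewrite lte_fin => ar.
by exists [set y | a < y] => //; exact: lt_nbhsr.
Qed.

(** The nonempty sublevel sets at levels above the infimum generate a proper
    filter on [A]; by lower semicontinuity a cluster point of that filter has
    value at most every such level, hence at most the infimum. *)
Lemma lsc_compact_min (T : topologicalType) (f : T -> \bar R) (A : set T) :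
  A !=set0 -> compact A -> lower_semicontinuous f ->
  exists2 c, A c & forall x, A x -> (f c <= f x)%E.
Proof.
move=> [x0 Ax0] cA lf; pose m := ereal_inf (f @` A).
have mA x : A x -> (m <= f x)%E.
  by move=> Ax; apply: ereal_inf_lbound; exists x.
suff [c Ac fcm] : exists2 c, A c & (f c <= m)%E.
  by exists c => // x /mA; exact: le_trans.
(* Without a real level above [m] the filter below would have no base. *)
have [my|/ereal_lt_dense[a0 /andP[ma0 _]]] := leP +oo%E m.
  by exists x0 => //; apply: le_trans my; rewrite leey.
pose F := filter_from [set a : R | (m < a%:E)%E]
            (fun a => A `&` [set x | (f x <= a%:E)%E]).
have FF : ProperFilter F.
  apply: filter_from_proper => [|a /ereal_inf_lt].
    apply: filter_from_filter; first by exists a0.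
    move=> a b ma mb; exists (Num.min a b).
      by rewrite /= EFin_min lt_min; apply/andP.
    by move=> x [Ax]/=; rewrite EFin_min le_min => /andP[].
  by move=> [_ [x Ax <-] fxa]; exists x; split=> //; exact: ltW.
have [|c [Ac Fc]] := cA F FF; first by exists a0 => // x [].
exists c => //; rewrite leNgt; apply/negP => /ereal_lt_dense[a /andP[ma afc]].
have [V Vc fV] := lf _ _ afc.
have [|x [[_ /= fxa] /fV]] := Fc (A `&` [set x | (f x <= a%:E)%E]) V _ Vc.
  by exists a.
by rewrite ltNge fxa.
Qed.

End Lsc.

(** * Finite-dimensional normed spaces *)

Section FiniteDim.
Context {R : realType}.

Lemma rV_linear_continuous (V : normedModType R) n
  (f : {linear 'rV[R]_n -> V}) : continuous f.
Proof.
apply: bounded_linear_continuous; apply/linear_boundedP.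
pose S := \sum_(i < n) `|f (delta_mx 0 i)|.
exists S; split=> [|r Sr u]; first exact: num_real.
apply: le_trans (ler_wpM2r (normr_ge0 u) (ltW Sr)).
rewrite {1}[u]row_sum_delta linear_sum/= mulr_suml.
apply: le_trans (ler_norm_sum _ _ _) _; apply: ler_sum => i _.
rewrite linearZ/= normrZ mulrC ler_wpM2l//.
rewrite [leRHS]/Num.Def.normr/= mx_normrE.
by apply/bigmax_geP; right => /=; exists (0, i).
Qed.

(** The constant is the minimum of the continuous function [`|f u|] over the
    unit sphere of row vectors, which is compact and which injectivity keeps
    away from the zeros of [f]; homogeneity extends the bound to all vectors. *)
Lemma rV_linear_lower_bound (V : normedModType R) n
    (f : {linear 'rV[R]_n -> V}) : injective f ->
  exists2 c : R, 0 < c & forall u, c * `|u| <= `|f u|.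
Proof.
move=> finj; pose S := [set u : 'rV[R]_n | `|u| = 1].
have cf : continuous (fun u => `|f u|).
  by move=> u; apply: (@continuous_comp _ _ _ f Num.norm);
    [exact: rV_linear_continuous|exact: norm_continuous].
have cS : compact S.
  apply: bounded_closed_compact.
    by exists 1; split=> [|r r1 u /= ->]; [exact: num_real|exact: ltW].
  rewrite (_ : S = Num.norm @^-1` [set 1])//.
  by apply: closed_comp => [u _|]; [exact: norm_continuous|exact: closed_eq].
(* The sphere is empty in dimension zero, where any constant works. *)
have [S0|S0] := pselect (S !=set0); last first.
  exists 1 => // u; have [->|u0] := eqVneq u 0; first by rewrite normr0 mulr0.
  exfalso; apply: S0; exists (`|u|^-1 *: u).
  by rewrite /S/= normrZ normfV normr_id mulVf// normr_eq0.
have [c /set_mem Sc cmin] := compact_EVT_min S0 cS (continuous_subspaceT cf).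
exists `|f c|.
  rewrite normr_gt0; apply/eqP => fc0.
  have c0 : c = 0 by apply: finj; rewrite fc0 linear0.
  by move: Sc; rewrite /S/= c0 normr0 => /eqP; rewrite eq_sym oner_eq0.
move=> u; have [->|u0] := eqVneq u 0; first by rewrite normr0 mulr0.
have nu : 0 < `|u| by rewrite normr_gt0.
rewrite -ler_pdivlMr//.
have /cmin : (`|u|^-1 *: u) \in S.
  by apply/mem_set; rewrite /S/= normrZ normfV normr_id mulVf// normr_eq0.
by rewrite linearZ/= normrZ normfV normr_id mulrC.
Qed.

(** The lower bound for [r2v] is an upper bound for its inverse. *)
Lemma v2r_continuous (H : finHilbertType R) :
  continuous (v2r : H -> 'rV[R]_(dim H)).
Proof.
have [c c0 cle] := rV_linear_lower_bound (can_inj (@r2vK R H)).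
apply: bounded_linear_continuous; apply/linear_boundedP.
exists c^-1; split=> [|r cr x]; first exact: num_real.
apply: le_trans (ler_wpM2r (normr_ge0 x) (ltW cr)).
by rewrite ler_pdivlMl//; have := cle (v2r x); rewrite /= v2rK.
Qed.

Lemma finHilbert_linear_continuous (H : finHilbertType R) (V : normedModType R)
  (f : {linear H -> V}) : continuous f.
Proof.
have -> : f = ((f \o r2v) \o v2r) :> (H -> V).
  by apply/funext => x /=; rewrite v2rK.
move=> x; apply: continuous_comp; first exact: v2r_continuous.
exact: rV_linear_continuous.
Qed.

(** The ball is the continuous image under [r2v] of its coordinate set, which is
    closed by continuity of [r2v] and bounded by [rV_linear_lower_bound]. *)
Lemma finHilbert_closed_ball_compact (H : finHilbertType R) (r : R) :
  compact [set x : H | `|x| <= r].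
Proof.
pose A := [set u : 'rV[R]_(dim H) | `|r2v u : H| <= r].
have -> : [set x : H | `|x| <= r] = r2v @` A.
  apply/seteqP; split=> [x xr|_ [u ? <-]//].
  by exists (v2r x); rewrite /A/= ?v2rK.
apply: continuous_compact.
  by apply: continuous_subspaceT; exact: rV_linear_continuous.
have [c c0 cle] := rV_linear_lower_bound (can_inj (@r2vK R H)).
apply: bounded_closed_compact.
  exists (c^-1 * r); split=> [|s rs u ur]; first exact: num_real.
  apply: le_trans (ltW rs); rewrite ler_pdivlMl//.
  exact: le_trans (cle u) ur.
rewrite (_ : A = (Num.norm \o r2v) @^-1` [set x | x <= r])//.
apply: closed_comp => [u _|]; last exact: closed_le.
apply: continuous_comp; first exact: rV_linear_continuous.
exact: norm_continuous.
Qed.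

(** A level [M] above some value of [f] is exceeded outside a closed ball, so a
    minimizer over that ball is a global one. *)
Lemma lsc_coercive_min_attained (H : finHilbertType R) (f : H -> \bar R) :
  lower_semicontinuous f -> coercive f -> min_attained f.
Proof.
move=> lf cf.
suff [c cmin] : exists c, forall x, (f c <= f x)%E.
  exists c; apply/eqP; rewrite eq_le; apply/andP; split.
    by apply: le_ereal_inf_tmp => _ [x _ <-].
  by apply: ereal_inf_lbound; exists c.
have [/existsNP[x0 /negP]|fy] := pselect (~ forall x, (+oo <= f x)%E);
  last first.
  by exists 0 => x; apply: le_trans (leey _) _; exact: (contrapT fy).
rewrite -ltNge => /ereal_lt_dense[M /andP[fx0M _]].
have [r fr] := cf M.
have x0r : `|x0| <= r.
  by rewrite leNgt; apply/negP => /fr; rewrite ltNge ltW.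
have [||c cr cmin] := @lsc_compact_min _ _ f [set x | `|x| <= r] _ _ lf.
- by exists x0.
- exact: finHilbert_closed_ball_compact.
exists c => x; have [/cmin//|/fr Mfx] := leP `|x| r.
by apply: le_trans (ltW Mfx); apply: le_trans (cmin _ x0r) _; exact: ltW.
Qed.

End FiniteDim.

(** * Sum with an indicator on a Hilbert product *)

Section Product.
Context {R : realType} {Z Zt K : finHilbertType R}.
Local Open Scope ereal_scope.

(** The projections are repackaged as linear maps on [hprod] so that their
    continuity for the Hilbert norm is an instance of
    [finHilbert_linear_continuous]. *)
Definition hfst (z : hprod Z K) : Z := z.1.
Definition hsnd (z : hprod Z K) : K := z.2.

Lemma hfst_is_linear : linear hfst. Proof. by []. Qed.
Lemma hsnd_is_linear : linear hsnd. Proof. by []. Qed.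

HB.instance Definition _ :=
  GRing.isLinear.Build R (hprod Z K) Z _ hfst hfst_is_linear.
HB.instance Definition _ :=
  GRing.isLinear.Build R (hprod Z K) K _ hsnd hsnd_is_linear.

Lemma eindic_in (C : set K) x : C x -> eindic C x = 0 :> \bar R.
Proof. by move=> Cx; rewrite /eindic mem_set. Qed.

Lemma eindic_out (C : set K) x : ~ C x -> eindic C x = +oo :> \bar R.
Proof. by move=> Cx; rewrite /eindic memNset. Qed.

Lemma eindic_ge0 (C : set K) x : 0 <= eindic C x :> \bar R.
Proof. by rewrite /eindic; case: ifP. Qed.

Lemma eindic_lsc (C : set K) : closed C ->
  lower_semicontinuous (eindic C : K -> \bar R).
Proof.
move=> cC x a; have [Cx|nCx _] := pselect (C x).
  rewrite eindic_in// => a0; exists setT; first exact: filterT.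
  by move=> y _; apply: lt_le_trans a0 (eindic_ge0 C y).
exists (~` C); first exact: (open_nbhs_nbhs (conj (closed_openC cC) nCx)).
by move=> y nCy; rewrite eindic_out// ltry.
Qed.

(** Off [C] the right-hand side is [+oo], except that a zero weight kills the
    infinite value; then the left-hand side is the value at the other point. *)
Lemma eindic_econvex (C : set K) : convex_set C ->
  econvex (eindic C : K -> \bar R).
Proof.
move=> cC x y t /andP[t0 t1].
have t1' : (0 <= 1 - t)%R by rewrite subr_ge0.
have [Cx|nCx] := pselect (C x); last first.
  move: t0; rewrite le_eqVlt => /predU1P[<-|t0].
    by rewrite subr0 scale0r scale1r add0r mul0e add0e mul1e.
  rewrite (eindic_out nCx) gt0_muley ?lte_fin// addye ?leey//.
  by rewrite gt_eqF// (lt_le_trans ltNy0)// mule_ge0// eindic_ge0.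
have [Cy|nCy] := pselect (C y); last first.
  move: t1'; rewrite le_eqVlt => /predU1P[e|t1'].
    have -> : t = 1%R by apply/eqP; rewrite eq_sym -subr_eq0 -e.
    by rewrite subrr scale0r scale1r addr0 mul0e adde0 mul1e.
  rewrite (eindic_out nCy) gt0_muley ?lte_fin// addey ?leey//.
  by rewrite gt_eqF// (lt_le_trans ltNy0)// mule_ge0// eindic_ge0.
rewrite (eindic_in Cx) (eindic_in Cy) !mule0 adde0 eindic_in//.
(* Convexity of sets is stated with weights bundled in the unit interval. *)
have ti : Itv.spec (@Itv.num_sem R) (Itv.Real `[0, 1]%Z) t.
  by apply/and3P; split; rewrite /= ?num_real// in_itv/= t0 t1.
by have := cC x y (Itv.mk ti) (mem_set Cx) (mem_set Cy) => /set_mem.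
Qed.

Lemma oplus_indic_lsc (Psi : Z -> \bar R) (C : set K) :
  lower_semicontinuous Psi -> closed C ->
  lower_semicontinuous (oplus_indic Psi C).
Proof.
move=> lPsi cC.
have lPsi1 : lower_semicontinuous (Psi \o hfst).
  by apply: lsc_comp lPsi; exact: finHilbert_linear_continuous.
have lC2 : lower_semicontinuous ((eindic C : K -> \bar R) \o hsnd).
  apply: lsc_comp (eindic_lsc cC); exact: finHilbert_linear_continuous.
exact: lscD lPsi1 lC2.
Qed.

Lemma oplus_indic_econvex (Psi : Z -> \bar R) (C : set K) :
  (forall z, -oo < Psi z) -> econvex Psi -> convex_set C ->
  econvex (oplus_indic Psi C).
Proof.
move=> PsiNy cPsi cC x y t t01; have /andP[t0 t1] := t01.
have PsiD z u : Psi z +? eindic C u.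
  apply: ltninfty_adde_def; rewrite inE ?PsiNy//.
  by rewrite (lt_le_trans ltNy0)// eindic_ge0.
rewrite /oplus_indic/= !muleDr// addeACA.
exact: leeD (cPsi _ _ _ t01) (eindic_econvex cC _ _ t01).
Qed.

Lemma oplus_indic_Gamma0 (Psi : Z -> \bar R) (C : set K) :
  Gamma0 Psi -> C !=set0 -> closed C -> convex_set C ->
  Gamma0 (oplus_indic Psi C).
Proof.
move=> [[PsiNy [z0 Psiz0]] lPsi cPsi] [c Cc] clC cC.
split; [split|exact: oplus_indic_lsc|exact: oplus_indic_econvex].
  move=> z; apply: lt_le_trans (PsiNy z.1) _.
  by rewrite /oplus_indic leeDl// eindic_ge0.
by exists (z0, c); rewrite /oplus_indic/= eindic_in// adde0.
Qed.

Lemma hprod_norml0 (a : Zt) : `|(a, 0) : hprod Zt K|%R = `|a|%R.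
Proof.
rewrite hprod_normr_inner hprod_innerE/= normr0 expr0n addr0.
by rewrite sqrtr_sqr normr_id.
Qed.

(** * Moreau enhanced penalties *)

Lemma GME_objective_min_attained (Psi : Z -> \bar R) (B : {linear Z -> Zt})
    (z : Z) : lower_semicontinuous Psi -> coercive Psi ->
  min_attained (GME_objective Psi B z).
Proof.
move=> lPsi cPsi; apply: lsc_coercive_min_attained.
  apply: lscD lPsi _; apply: continuous_lsc => v.
  have cB : {for v, continuous (fun v => `|B (z - v)|%R)}.
    apply: (@continuous_comp _ _ _ (fun v => B (z - v)%R) Num.norm);
      last exact: norm_continuous.
    apply: (@continuous_comp _ _ _ (fun v => z - v)%R B);
      last exact: finHilbert_linear_continuous.
    by apply: cvgB; [exact: cvg_cst|exact: cvg_id].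
  by apply: cvgM; [exact: cvg_cst|exact: cvgM].
move=> M; have [r rM] := cPsi M; exists r => x /rM Mx.
apply: lt_le_trans Mx _.
by rewrite leeDl// lee_fin mulr_ge0// ?sqr_ge0// invr_ge0.
Qed.

Lemma GME_objective_oplus (Psi : Z -> \bar R) (B : {linear Z -> Zt})
    (C : set K) (z v : hprod Z K) :
  GME_objective (oplus_indic Psi C) (oplus_zero B) z v =
  GME_objective Psi B z.1 v.1 + eindic C v.2.
Proof.
by rewrite /GME_objective /oplus_indic /= hprod_norml0 addeAC.
Qed.

(** An indicator only raises values, and it vanishes at any chosen point of [C],
    so the free component contributes nothing to the infimum. *)
Lemma emin_GME_objective_oplus (Psi : Z -> \bar R) (B : {linear Z -> Zt})
    (C : set K) (z : hprod Z K) : C !=set0 ->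
  emin (GME_objective (oplus_indic Psi C) (oplus_zero B) z) =
  emin (GME_objective Psi B z.1).
Proof.
move=> [c Cc]; apply/eqP; rewrite eq_le; apply/andP; split.
  apply: le_ereal_inf_tmp => _ [v _ <-]; apply: ereal_inf_lbound.
  by exists (v, c); rewrite // GME_objective_oplus/= eindic_in// adde0.
apply: le_ereal_inf_tmp => _ [v _ <-]; rewrite GME_objective_oplus.
apply: le_trans (leeDl _ (eindic_ge0 C v.2)).
by apply: ereal_inf_lbound; exists v.1.
Qed.

End Product.


Theorem lemma1 (R : realType) (X Y Z Zt K : finHilbertType R)
    (C : set K) (Psi : Z -> \bar R) (y : Y)
    (A : {linear X -> Y}) (B : {linear Z -> Zt})
    (L : {linear X -> Z}) (D : {linear X -> K}) (mu : R)
    (C_neq0 : C !=set0) (C_closed : closed C) (C_convex : convex_set C)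
    (Psi_Gamma0 : Gamma0 Psi) (Psi_coercive : coercive Psi)
    (Psi_dom : edom Psi = [set: Z])
    (mu_gt0 : 0 < mu) (C_ran : C `&` range D !=set0) :
  let Lc : {linear X -> hprod Z K} := pair_op L D in
  let Bc : {linear hprod Z K -> hprod Zt K} := oplus_zero B in
  let Psic : hprod Z K -> \bar R := oplus_indic Psi C in
  let J : X -> \bar R := penalized_ls A y mu (GME Psic Bc \o Lc) in
  [/\ Gamma0 Psic,
      (forall z : Z, min_attained (GME_objective Psi B z)) /\
      (forall z : hprod Z K, min_attained (GME_objective Psic Bc z)),
      forall (z1 : Z) (z2 : K),
        GME Psic Bc (z1, z2) = (GME Psi B z1 + eindic C z2)%E &
      forall x : X,
        (C (D x) -> J x = penalized_ls A y mu (GME Psi B \o L) x) /\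
        (~ C (D x) -> J x = +oo%E)].
Proof.
move=> Lc Bc Psic J.
have [[PsiNy _] lPsi _] := Psi_Gamma0.
have Psi_fin z : Psi z \is a fin_num.
  by rewrite fin_numElt PsiNy/=; have : edom Psi z by rewrite Psi_dom.
have minZ z := GME_objective_min_attained B z lPsi Psi_coercive.
have emin_fin z : emin (GME_objective Psi B z) \is a fin_num.
  by have [v <-] := minZ z; rewrite fin_numD Psi_fin.
have GMEE z1 z2 : GME Psic Bc (z1, z2) = (GME Psi B z1 + eindic C z2)%E.
  by rewrite /GME emin_GME_objective_oplus//= addeAC.
split => //; first exact: oplus_indic_Gamma0.
  split=> // z; have [v vmin] := minZ z.1; have [c Cc] := C_neq0.
  exists (v, c).
  by rewrite emin_GME_objective_oplus// GME_objective_oplus eindic_in// adde0.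
move=> x; rewrite /J /penalized_ls /= /pair_op GMEE; split=> Cx.
  by rewrite eindic_in// adde0.
rewrite eindic_out// addey; last first.
  by rewrite gt_eqF// ltNye_eq fin_numB Psi_fin emin_fin.
by rewrite gt0_muley ?lte_fin// addey.
Qed.
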